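(* Let $\mathbb X$ and $\mathbb Y$ be Hilbert spaces, let $\mathbf A\colon\mathbb X\to\mathbb Y$ be a bounded linear operator, let $\lambda\in(0,1/\|\mathbf A\|^2)$, let $(t_k)_{k\in\mathbb N}$ be a summable sequence of nonnegative numbers, and let $(\Phi_k)_{k\in\mathbb N}$ be a family of continuous mappings $\Phi_k\colon\mathbb X\to\mathbb X$ with $\sup_k\sup_{x\in\mathbb X}\|\Phi_k(x)\|<\infty$. Let $\mathbf B_k\colon\mathbb Y\to\mathbb X$ be the mapping sending data to the $k$-th iterate of the perturbed Landweber iteration, and let $\mathbf B\colon\mathbf A(\mathbb X)\to\mathbb X$, $\mathbf B(y)=\lim_{k\to\infty}\mathbf B_k(y)$, be the right inverse of $\mathbf A$ it defines (see context). Then for all $y\in\mathbf A(\mathbb X)$ there exists a parameter choice rule $\kappa\colon(0,\infty)\to\mathbb N$ such that the pair $((\mathbf B_k)_{k\in\mathbb N},\kappa)$ is a regularization method for the solution of $\mathbf A x=y$ adapted to $\mathbf B$. In particular, $$\lim_{\delta\to0}\|\mathbf B(y)-\mathbf B_{\kappa(\delta)}(y^\delta)\|=0$$ for all families of noisy data $(y^\delta)_{\delta>0}$ in $\mathbb Y$ with $\|y-y^\delta\|\le\delta$. Moreover, the truncated iterates form a regularization $(\mathbf B_k)_{k\in\mathbb N}$ of $\mathbf B$.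
   Context: $\mathbf A^*$ denotes the adjoint of $\mathbf A$. For data $z\in\mathbb Y$, the perturbed (superiorized) Landweber iteration is defined by $x_0=0$ and $$x_{k+1/2}=x_k+t_k\Phi_k(x_k),\qquad x_{k+1}=x_{k+1/2}-\lambda\,\mathbf A^*(\mathbf A x_{k+1/2}-z)\qquad(k\in\mathbb N),$$ and $\mathbf B_k(z):=x_k$. For exact data $y\in\mathbf A(\mathbb X)$ the iterates $\mathbf B_k(y)$ converge in norm to a solution of $\mathbf A x=y$, and $\mathbf B(y):=\lim_{k\to\infty}\mathbf B_k(y)$; thus $\mathbf B$ is a right inverse of $\mathbf A$, i.e. $\mathbf A(\mathbf B(y))=y$ for all $y\in\mathbf A(\mathbb X)$ ($\mathbf B$ may be non-linear). Regularization: let $\mathbf R\colon\mathbf A(\mathbb X)\to\mathbb X$ be a (possibly non-linear) right inverse of $\mathbf A$. A family $(\mathbf R_k)_{k\in\mathbb N}$ of continuous (possibly non-linear) operators $\mathbf R_k\colon\mathbb Y\to\mathbb X$ is called a regularization of $\mathbf R$ if for all $y\in\mathbf A(\mathbb X)$ there exists a mapping $\kappa\colon(0,\infty)\to\mathbb N$ with $\kappa(\delta)\to\infty$ as $\delta\to0$ and $$\lim_{\delta\to0}\sup\bigl\{\|\mathbf R(y)-\mathbf R_{\kappa(\delta)}(y^\delta)\| \;\big|\; y^\delta\in\mathbb Y,\ \|y^\delta-y\|\le\delta\bigr\}=0.$$ In this case, $\kappa$ (which may depend on $y$) is called an (a-priori) parameter choice rule, and the pair $((\mathbf R_k)_{k\in\mathbb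 N},\kappa)$ is called a regularization method for the solution of $\mathbf A x=y$ (adapted to $\mathbf R$). *)

(* Defs.v *)
From HB Require Import structures.
From mathcomp Require Import all_boot all_order all_algebra.
From mathcomp Require Import sesquilinear complex.
From mathcomp Require Import all_classical all_reals all_analysis.

Set Implicit Arguments.
Unset Strict Implicit.
Unset Printing Implicit Defensive.

Import Order.TTheory GRing.Theory Num.Theory.
Import numFieldNormedType.Exports.

Local Open Scope classical_set_scope.
Local Open Scope ring_scope.

(* Real and complex Hilbert spaces are treated uniformly: the scalar field is
   [R] or [R[i]]. *)
Variant scalar_kind := RealScalars | ComplexScalars.

Definition scalar_field (R : realType) (s : scalar_kind) : numFieldType :=
  match s with RealScalars => R | ComplexScalars => R[i] end.

Definition scalar_conj (R : realType) (s : scalar_kind) :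
    scalar_field R s -> scalar_field R s :=
  match s with RealScalars => idfun | ComplexScalars => @conjc R end.

Definition scalar_re (R : realType) (s : scalar_kind) : scalar_field R s -> R :=
  match s with RealScalars => idfun | ComplexScalars => @complex.Re R end.

Definition of_real (R : realType) (s : scalar_kind) : R -> scalar_field R s :=
  match s with RealScalars => idfun | ComplexScalars => real_complex R end.

(* [inner] is linear in its first argument and conjugate-linear in the second.
   Completeness and the topology come from [completeNormedModType]; [innerE]
   says that the norm is the one induced by the inner product. *)
HB.mixin Record NormedModule_hasInner (R : realType) (s : scalar_kind) X
    of NormedModule (scalar_field R s) X := {
  inner : {dot X for @scalar_conj R s};
  innerE : forall x : X, inner x x = `|x| ^+ 2
}.

#[short(type="hilbertType")]
HB.structure Definition Hilbert (R : realType) (s : scalar_kind) :=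
  { X of CompleteNormedModule (scalar_field R s) X & NormedModule_hasInner R s X }.

(* The norm of a normed module over [K] takes its values in [K]; [rnorm] is the
   same norm, viewed as a real number. *)
Definition rnorm (R : realType) (s : scalar_kind)
    (X : normedModType (scalar_field R s)) (x : X) : R := scalar_re `|x|.

Section Operators.
Context (R : realType) (s : scalar_kind) (X Y : hilbertType R s).

Definition bounded_operator (A : {linear X -> Y}) : Prop :=
  exists M : R, forall x : X, rnorm (A x) <= M * rnorm x.

Definition opnorm (A : {linear X -> Y}) : R :=
  sup [set rnorm (A x) | x in [set x : X | rnorm x <= 1]].

Definition is_adjoint (A : {linear X -> Y}) (B : Y -> X) : Prop :=
  forall x y, inner (A x) y = inner x (B y).

(* The adjoint exists and is unique for bounded operators on Hilbert spaces. *)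
Definition adjoint (A : {linear X -> Y}) : Y -> X :=
  xget (fun=> 0) [set B | is_adjoint A B].

End Operators.

Section Landweber.
Context (R : realType) (s : scalar_kind) (X Y : hilbertType R s).
Variables (A : {linear X -> Y}) (lambda : R) (t : R^nat) (Phi : nat -> X -> X).

Fixpoint landweber (k : nat) (z : Y) : X :=
  if k is j.+1 then
    let x := landweber j z in
    let x' := x + of_real s (t j) *: Phi j x in
    x' - of_real s lambda *: adjoint A (A x' - z)
  else 0.

(* Only relevant on [range A]. *)
Definition landweber_lim (y : Y) : X := lim (landweber k y @[k --> \oo]).

End Landweber.

Section Regularization.
Context (R : realType) (s : scalar_kind) (X Y : hilbertType R s).
Variables (A : {linear X -> Y}) (Rinv : Y -> X) (Rk : nat -> Y -> X).

(* A map [range A -> X] is represented by a total map [Y -> X] whose values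
   outside [range A] are never used. *)
Definition right_inverse_on_range : Prop := forall y, range A y -> A (Rinv y) = y.

(* The supremum is taken in the extended reals, so that it is [+oo] when the
   set of errors is unbounded. *)
Definition worst_case_error (k : nat) (y : Y) (delta : R) : \bar R :=
  ereal_sup [set (rnorm (Rinv y - Rk k yd))%:E
            | yd in [set yd : Y | rnorm (yd - y) <= delta]].

Definition parameter_choice_rule (y : Y) (kappa : R -> nat) : Prop :=
  kappa delta @[delta --> 0^'+] --> \oo /\
  worst_case_error (kappa delta) y delta @[delta --> 0^'+] --> 0%E.

Definition regularization : Prop :=
  [/\ right_inverse_on_range,
      forall k, continuous (Rk k) &
      forall y, range A y -> exists kappa, parameter_choice_rule y kappa].

Definition regularization_method (y : Y) (kappa : R -> nat) : Prop :=
  [/\ right_inverse_on_range,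
      forall k, continuous (Rk k) &
      parameter_choice_rule y kappa].

End Regularization.

(* Main.v *)
Require Import Defs.
From HB Require Import structures.
From mathcomp Require Import all_boot all_order all_algebra.
From mathcomp Require Import sesquilinear complex.
From mathcomp Require Import all_classical all_reals all_analysis.
From mathcomp Require Import ring lra.

Import Order.TTheory GRing.Theory Num.Theory.
Import numFieldNormedType.Exports.

Local Open Scope classical_set_scope.
Local Open Scope ring_scope.

(** The iterates are continuous in the data and converge for exact data; these
two facts alone give a regularization.

For exact data [y = A x0], the errors [e k = x k - x0] obey
[e k.+1 = P (e k + p k)] with [P = 1 - lambda A* A] and [p k = t k Phi k (x k)],
a perturbation of summable norm.  The bound [lambda |A|^2 < 1] makes the
symmetric operator [P] firmly nonexpansive, [|P x|^2 <= <P x, x>]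
([landweber_step_firm]).  Hence the moments [<P^k v, v>] decrease and are
nonnegative, and since
[|P^m v - P^n v|^2 = <P^2m v, v> - 2 <P^(m+n) v, v> + <P^2n v, v>],
every unperturbed orbit is Cauchy ([firm_orbit_cauchy]).  From time [m] on, the perturbed errors stay within the tail
[sum_(j >= m) |p j|] of the unperturbed orbit of [e m], so they are Cauchy too,
and their limit is a fixed point of [P], that is, a zero of [A]
([perturbed_orbit_cvg], [landweber_step_fixed]).  The iterates therefore
converge to a solution, and the limit map is a right inverse of [A].

The step involves [A*] as an operator chosen by a description, so the existence
of the adjoint has to be established: it comes from the Riesz representation
theorem, obtained by minimizing [|x|^2 / 2 - f x] ([riesz_real], [adjointP]).
Real and complex scalars are handled together by using only the real part of
the inner product, which determines the norm and turns every argument above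
into one about a real Hilbert space.

For the stopping rule, [kappa delta] is the largest index [k] below the integer
part of [1 / delta] such that data within [delta] of [y] move the [k]-th iterate by at most [1 / (k + 1)].
Continuity of each iterate at [y] makes every fixed [k] eventually admissible, so
[kappa delta] tends to infinity as [delta] tends to [0]; the error is then at
most [|B y - B_k y| + 1 / (k + 1)] for [k = kappa delta], which tends to [0]
([parameter_choice_exists]). *)

(** * Real parts of scalars and real-valued norms *)

Section Scalars.
Context {R : realType} {s : scalar_kind}.
Implicit Types (a b : R) (z w : scalar_field R s).

Lemma scalar_reD z w : scalar_re (z + w) = scalar_re z + scalar_re w.
Proof. by case: s z w => //= -[? ?] [? ?]. Qed.

Lemma scalar_reN z : scalar_re (- z) = - scalar_re z.
Proof. by case: s z => //= -[? ?]. Qed.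

Lemma scalar_re0 : scalar_re (0 : scalar_field R s) = 0.
Proof. by case: s. Qed.

Lemma scalar_reM a z : scalar_re (of_real s a * z) = a * scalar_re z.
Proof. by case: s z => //= -[x y]; simpc. Qed.

Lemma scalar_re_conj z : scalar_re (scalar_conj z) = scalar_re z.
Proof. by case: s z => //= -[? ?]. Qed.

Lemma of_realK a : scalar_re (of_real s a) = a.
Proof. by case: s. Qed.

Lemma of_realD a b : of_real s (a + b) = of_real s a + of_real s b.
Proof. by case: s => //=; rewrite rmorphD. Qed.

Lemma of_real0 : of_real s 0 = 0 :> scalar_field R s.
Proof. by case: s. Qed.

Lemma of_real_le a b : (of_real s a <= of_real s b) = (a <= b).
Proof. by case: s => //=; rewrite lecR. Qed.

Lemma of_real_lt a b : (of_real s a < of_real s b) = (a < b).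
Proof. by case: s => //=; rewrite ltcR. Qed.

Lemma norm_of_real a : `|of_real s a| = of_real s `|a|.
Proof. by case: s => //=; rewrite normc_def /= expr0n addr0 sqrtr_sqr. Qed.

Lemma scalar_reK z : 0 <= z -> of_real s (scalar_re z) = z.
Proof. by case: s z => //= z z0; rewrite RRe_real// ger0_real. Qed.

(** Taking [c] to be the conjugate of [z] turns the real part into a squared
modulus. This recovers identities of scalars from identities of real parts. *)
Lemma scalar_re_separated z :
  (forall c, scalar_re (c * z) = 0) -> z = 0.
Proof.
case: s z => [z /(_ z)/eqP|[x y] /(_ (x -i* y)%C)] /=.
  by rewrite mulf_eq0 orbb => /eqP.
rewrite mulNr opprK => /eqP; rewrite paddr_eq0 ?mulf_eq0 ?orbb.
- by move=> /andP[/eqP-> /eqP->].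
- exact: sqr_ge0.
- exact: sqr_ge0.
Qed.

End Scalars.

Section RealNorm.
Context {R : realType} {s : scalar_kind} {X : normedModType (scalar_field R s)}.
Implicit Types (x y : X) (a : R).

Lemma of_real_rnorm x : of_real s (rnorm x) = `|x|.
Proof. exact: scalar_reK. Qed.

Lemma rnorm_ge0 x : 0 <= rnorm x.
Proof. by rewrite -(of_real_le (s:=s)) of_real_rnorm of_real0. Qed.

Lemma rnorm0 : rnorm (0 : X) = 0.
Proof. by rewrite /rnorm normr0 scalar_re0. Qed.

Lemma rnorm_eq0 x : rnorm x = 0 -> x = 0.
Proof.
by move=> x0; apply/normr0_eq0; rewrite -of_real_rnorm x0 of_real0.
Qed.

Lemma rnormD x y : rnorm (x + y) <= rnorm x + rnorm y.
Proof.
by rewrite -(of_real_le (s:=s)) of_realD !of_real_rnorm ler_normD.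
Qed.

Lemma rnormN x : rnorm (- x) = rnorm x.
Proof. by rewrite /rnorm normrN. Qed.

Lemma rdistC x y : rnorm (x - y) = rnorm (y - x).
Proof. by rewrite -rnormN opprB. Qed.

Lemma rdist_triangle z x y : rnorm (x - y) <= rnorm (x - z) + rnorm (z - y).
Proof. by apply: le_trans (rnormD _ _); rewrite addrA subrK. Qed.

Lemma rnormZ a x : rnorm (of_real s a *: x) = `|a| * rnorm x.
Proof.
by rewrite /rnorm normrZ norm_of_real scalar_reM.
Qed.

(** The library criterion quantifies over positive scalars [e]; a positive complex
number is real, so real tolerances suffice. *)
Lemma cvg_rnormP {T : Type} {F : set_system T} {FF : Filter F}
    (f : T -> X) (x : X) :
  f t @[t --> F] --> x <->
  (forall e : R, 0 < e -> \forall t \near F, rnorm (x - f t) <= e).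
Proof.
split=> [/cvgrPdist_le fx e e0|fx].
  have : 0 < of_real s e by rewrite -of_real0 of_real_lt.
  move=> /fx; apply: filterS => t.
  by rewrite -of_real_rnorm of_real_le.
apply/cvgrPdist_le => e e0.
have re : of_real s (scalar_re e) = e by apply/scalar_reK/ltW.
have /fx : 0 < scalar_re e by rewrite -(of_real_lt (s:=s)) re of_real0.
apply: filterS => t ft.
by rewrite -of_real_rnorm -re of_real_le.
Qed.

Lemma cvg_rnorm0P {T : Type} {F : set_system T} {FF : Filter F}
    (f : T -> X) (x : X) :
  f t @[t --> F] --> x <-> rnorm (x - f t) @[t --> F] --> 0.
Proof.
rewrite cvg_rnormP cvgr0Pnorm_le.
by split=> h e /h; apply: filterS => t; rewrite ger0_norm ?rnorm_ge0.
Qed.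

End RealNorm.

Lemma cauchy_rnorm_cvgn {R : realType} {s : scalar_kind}
    {X : completeNormedModType (scalar_field R s)} (u : nat -> X) :
  (forall e : R, 0 < e ->
     exists N, forall m n, (N <= m)%N -> (N <= n)%N -> rnorm (u m - u n) <= e) ->
  cvgn u.
Proof.
move=> uC; apply: cauchy_cvg; apply/cauchy_ballP => e e0.
have re : of_real s (scalar_re e) = e by apply/scalar_reK/ltW.
have e2 : 0 < scalar_re e / 2.
  by rewrite divr_gt0// -(of_real_lt (s:=s)) re of_real0.
have [N uN] := uC _ e2.
exists (u @` [set n | (N <= n)%N], u @` [set n | (N <= n)%N]).
  by split; exists N => // n Nn; exists n.
move=> [_ _] [/= [m Nm <-] [n Nn <-]]; rewrite -ball_normE /ball_ /=.
rewrite -of_real_rnorm -[ltRHS]re of_real_lt.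
by apply: le_lt_trans (uN _ _ Nm Nn) _; lra.
Qed.

(** * The real inner product *)

Section RealInner.
Context {R : realType} {s : scalar_kind} {X : hilbertType R s}.
Implicit Types (x y z h : X) (a : R).

Definition re_inner x y : R := scalar_re (inner x y).

Lemma re_innerC x y : re_inner x y = re_inner y x.
Proof.
rewrite /re_inner (@hermitian_subproof _ _ _ _ (@inner R s X)) expr0 mul1r.
exact: scalar_re_conj.
Qed.

Lemma re_innerDl x y z : re_inner (x + y) z = re_inner x z + re_inner y z.
Proof. by rewrite /re_inner linearDl scalar_reD. Qed.

Lemma re_innerDr x y z : re_inner z (x + y) = re_inner z x + re_inner z y.
Proof. by rewrite re_innerC re_innerDl !(re_innerC z). Qed.

Lemma re_innerNl x z : re_inner (- x) z = - re_inner x z.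
Proof. by rewrite /re_inner linearNl scalar_reN. Qed.

Lemma re_innerNr x z : re_inner z (- x) = - re_inner z x.
Proof. by rewrite re_innerC re_innerNl (re_innerC z). Qed.

Lemma re_innerZl a x z : re_inner (of_real s a *: x) z = a * re_inner x z.
Proof. by rewrite /re_inner linearZl_LR scalar_reM. Qed.

Lemma re_innerZr a x z : re_inner z (of_real s a *: x) = a * re_inner z x.
Proof. by rewrite re_innerC re_innerZl (re_innerC z). Qed.

Lemma re_inner_sqr x : re_inner x x = rnorm x ^+ 2.
Proof.
by rewrite /re_inner innerE -of_real_rnorm expr2 scalar_reM of_realK -expr2.
Qed.

Lemma rnorm_sqrD x y :
  rnorm (x + y) ^+ 2 = rnorm x ^+ 2 + 2 * re_inner x y + rnorm y ^+ 2.
Proof.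
rewrite -!re_inner_sqr re_innerDl !re_innerDr (re_innerC y x); ring.
Qed.

Lemma rnorm_sqrB x y :
  rnorm (x - y) ^+ 2 = rnorm x ^+ 2 - 2 * re_inner x y + rnorm y ^+ 2.
Proof. by rewrite rnorm_sqrD rnormN re_innerNr mulrN. Qed.

(** Expand the squared norm of [|y|^2 x - <x, y> y]: scaling by [|y|^2] avoids the
division in the usual projection of [x] on [y]. *)
Lemma cauchy_schwarz x y : `|re_inner x y| <= rnorm x * rnorm y.
Proof.
have [y0|y0] := eqVneq (rnorm y) 0.
  rewrite (rnorm_eq0 _ y0) rnorm0 mulr0.
  by rewrite -(subrr y) re_innerDr re_innerNr subrr normr0.
have yp : 0 < rnorm y ^+ 2 by rewrite exprn_gt0// lt_def y0 rnorm_ge0.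
rewrite -ler_sqr ?nnegrE ?mulr_ge0 ?rnorm_ge0// real_normK ?num_real//.
have := sqr_ge0 (rnorm (of_real s (rnorm y ^+ 2) *: x
                        - of_real s (re_inner x y) *: y)).
rewrite rnorm_sqrB !rnormZ re_innerZl re_innerZr !exprMn.
rewrite !real_normK ?num_real// => h.
rewrite -(ler_pM2l yp); nra.
Qed.

Lemma re_inner_eq x x' :
  (forall z, re_inner z x = re_inner z x') -> x = x'.
Proof.
move=> xx'; apply/subr0_eq/rnorm_eq0/eqP.
by rewrite -sqrf_eq0 -re_inner_sqr re_innerDr re_innerNr xx' subrr.
Qed.

Lemma cvg_re_innerl (u : nat -> X) x h :
  u n @[n --> \oo] --> x -> re_inner (u n) h @[n --> \oo] --> re_inner x h.
Proof.
move=> /cvg_rnormP ux; apply/cvgrPdist_le => e e0.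
have h1 : 0 < rnorm h + 1 by rewrite ltr_wpDl ?rnorm_ge0.
have /ux : 0 < e / (rnorm h + 1) by rewrite divr_gt0.
apply: filterS => n; rewrite ler_pdivlMr// => un.
rewrite -re_innerNl -re_innerDl.
apply: le_trans (cauchy_schwarz _ _) (le_trans _ un).
by rewrite ler_wpM2l ?rnorm_ge0 ?lerDl.
Qed.

End RealInner.

(** * Riesz representation and the adjoint *)

Section Riesz.
Context {R : realType} {s : scalar_kind} {X : hilbertType R s}.
Variables (f : X -> R) (C : R).
Hypothesis fD : forall x y, f (x + y) = f x + f y.
Hypothesis fZ : forall a x, f (of_real s a *: x) = a * f x.
Hypothesis f_bounded : forall x, `|f x| <= C * rnorm x.

(** The functional whose minimizer is the vector representing [f]. *)
Let energy (x : X) : R := rnorm x ^+ 2 / 2 - f x.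

Let energy_lbound (x : X) : - (C ^+ 2 / 2) <= energy x.
Proof.
have := le_trans (ler_norm _) (f_bounded x).
have := sqr_ge0 (rnorm x - C); rewrite /energy; nra.
Qed.

Let energy_range_has_inf : has_inf (range energy).
Proof.
split; first by exists (energy 0); exists 0.
by exists (- (C ^+ 2 / 2)) => _ [x _ <-]; exact: energy_lbound.
Qed.

Let m : R := inf (range energy).

Let energy_ge_inf (x : X) : m <= energy x.
Proof. by apply: ge_inf; [exact: energy_range_has_inf.2|exists x]. Qed.

(** Parallelogram law: the energy of the midpoint of [x] and [y] falls short of the
mean of their energies by [|x - y|^2 / 8], and it is at least the infimum. So
minimizing sequences are Cauchy. *)
Let energy_midpoint (x y : X) :
  rnorm (x - y) ^+ 2 <= 4 * ((energy x - m) + (energy y - m)).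
Proof.
have := energy_ge_inf (of_real s 2^-1 *: (x + y)).
rewrite /energy fZ fD rnormZ ger0_norm ?invr_ge0// exprMn.
rewrite rnorm_sqrB rnorm_sqrD; lra.
Qed.

(** Compare [x] with [x - a h]. As [x] runs through a minimizing sequence the right
side vanishes, which leaves the first-order condition of a minimizer. *)
Let energy_variation (x h : X) (a : R) :
  a * (re_inner x h - f h) - a ^+ 2 * rnorm h ^+ 2 / 2 <= energy x - m.
Proof.
have := energy_ge_inf (x + of_real s (- a) *: h).
rewrite /energy fD fZ rnorm_sqrD re_innerZr rnormZ exprMn.
rewrite real_normK ?num_real// sqrrN; lra.
Qed.

(** Real-linearity is all that is asked of [f], so this applies to the real part of
a complex functional. *)
Lemma riesz_real : exists w : X, forall x, f x = re_inner w x.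
Proof.
have /choice[u uP] : forall n : nat, exists x, energy x - m < n.+1%:R^-1.
  move=> n; have e0 : 0 < n.+1%:R^-1 :> R by rewrite invr_gt0.
  have [_ [x _ <-] xm] := inf_adherent e0 energy_range_has_inf.
  by exists x; rewrite ltrBlDl.
have /cvg_ex[w uw] : cvgn u.
  apply: cauchy_rnorm_cvgn => e e0.
  have e8 : 0 < e ^+ 2 / 8 by rewrite divr_gt0 ?exprn_gt0.
  have [N _ NP] := near_infty_natSinv_lt (PosNum e8).
  have uN n : (N <= n)%N -> energy (u n) - m < e ^+ 2 / 8.
    by move=> /NP; apply: lt_trans.
  exists N => i j /uN Ni /uN Nj; rewrite -ler_sqr ?nnegrE ?rnorm_ge0 ?(ltW e0)//.
  apply: le_trans (energy_midpoint _ _) _; move: Ni Nj; lra.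
exists w => h; apply/esym/eqP; rewrite -subr_eq0; apply/eqP.
set g := _ - _.
(* [a g <= a^2 |h|^2 / 2] for all [a] forces [g = 0]; below, [a] is taken to be
   [g / (|h|^2 + 1)]. *)
have gle a : a * g - a ^+ 2 * rnorm h ^+ 2 / 2 <= 0.
  have lim0 := @cvg_harmonic R.
  have limg : a * (re_inner (u n) h - f h) - a ^+ 2 * rnorm h ^+ 2 / 2
      @[n --> \oo] --> a * g - a ^+ 2 * rnorm h ^+ 2 / 2.
    apply: cvgB; last exact: cvg_cst.
    apply: cvgMr; apply: cvgB; last exact: cvg_cst.
    exact: cvg_re_innerl.
  apply: (ler_cvg_to limg lim0); near=> n.
  by apply: le_trans (energy_variation _ _ _) _; rewrite ltW.
have h1 : 0 < rnorm h ^+ 2 + 1 by rewrite ltr_wpDl ?sqr_ge0.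
have := gle (g / (rnorm h ^+ 2 + 1)).
have -> : g / (rnorm h ^+ 2 + 1) * g
    - (g / (rnorm h ^+ 2 + 1)) ^+ 2 * rnorm h ^+ 2 / 2
  = (g / (rnorm h ^+ 2 + 1)) ^+ 2 * (rnorm h ^+ 2 / 2 + 1).
  by field; rewrite gt_eqF.
rewrite pmulr_lle0; last by rewrite ltr_wpDl ?divr_ge0 ?sqr_ge0.
move=> le0; have /eqP : (g / (rnorm h ^+ 2 + 1)) ^+ 2 = 0.
  by apply/le_anti; rewrite le0 sqr_ge0.
by rewrite sqrf_eq0 mulf_eq0 invr_eq0 (gt_eqF h1) orbF => /eqP.
Unshelve. all: by end_near. Qed.

End Riesz.

Section Adjoint.
Context {R : realType} {s : scalar_kind} {X Y : hilbertType R s}.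
Context {A : {linear X -> Y}}.
Hypothesis A_bounded : bounded_operator A.

(** The Riesz vectors [B y] of the functionals [x |-> Re <A x, y>] satisfy the
adjoint identity for real parts; applying it to all multiples [c x] removes the
real part. *)
Lemma adjointP : is_adjoint A (adjoint A).
Proof.
apply: (@xgetPex _ (fun=> 0) [set B | is_adjoint A B]).
have [C AC] := A_bounded.
have /choice[B BP] : forall y, exists w, forall x,
    re_inner (A x) y = re_inner w x.
  move=> y.
  apply: (@riesz_real _ _ _ (fun x => re_inner (A x) y) (C * rnorm y)).
  - by move=> x x'; rewrite linearD re_innerDl.
  - by move=> a x; rewrite linearZ re_innerZl.
  - move=> x; apply: le_trans (cauchy_schwarz _ _) _.
    by rewrite mulrAC ler_wpM2r ?rnorm_ge0.
exists B => x y /=; apply/eqP; rewrite -subr_eq0; apply/eqP.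
apply: scalar_re_separated => c.
rewrite mulrBr -!linearZl_LR -linearZ scalar_reD scalar_reN.
by apply/eqP; rewrite subr_eq0; apply/eqP; rewrite -!/(re_inner _ _) BP re_innerC.
Qed.

Lemma re_inner_adjoint x y : re_inner (A x) y = re_inner x (adjoint A y).
Proof. by rewrite /re_inner adjointP. Qed.

Lemma adjointD y y' : adjoint A (y + y') = adjoint A y + adjoint A y'.
Proof.
by apply: re_inner_eq => z; rewrite re_innerDr -!re_inner_adjoint re_innerDr.
Qed.

Lemma adjointN y : adjoint A (- y) = - adjoint A y.
Proof.
by apply: re_inner_eq => z; rewrite re_innerNr -!re_inner_adjoint re_innerNr.
Qed.

Let opnorm_has_ubound :
  has_ubound [set rnorm (A x) | x in [set x : X | rnorm x <= 1]].
Proof.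
have [C AC] := A_bounded.
exists `|C| => _ [z /= z1 <-]; apply: le_trans (AC z) _.
apply: le_trans (ler_wpM2r (rnorm_ge0 z) (ler_norm C)) _.
by rewrite ler_piMr.
Qed.

Lemma rnorm_le_opnorm x : rnorm (A x) <= opnorm A * rnorm x.
Proof.
have [x0|x0] := eqVneq (rnorm x) 0.
  by rewrite (rnorm_eq0 _ x0) linear0 !rnorm0 mulr0.
have xp : 0 < rnorm x by rewrite lt_def x0 rnorm_ge0.
rewrite -ler_pdivrMr//.
have -> : rnorm (A x) / rnorm x = rnorm (A (of_real s (rnorm x)^-1 *: x)).
  by rewrite linearZ rnormZ ger0_norm ?invr_ge0 ?rnorm_ge0// mulrC.
apply: ub_le_sup; first exact: opnorm_has_ubound.
exists (of_real s (rnorm x)^-1 *: x) => //=.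
by rewrite rnormZ ger0_norm ?invr_ge0 ?rnorm_ge0// mulVf.
Qed.

Lemma opnorm_ge0 : 0 <= opnorm A.
Proof.
apply: ub_le_sup; first exact: opnorm_has_ubound.
by exists 0; rewrite /= ?linear0 ?rnorm0.
Qed.

(** [|A* y|^2 = <A A* y, y> <= |A| |A* y| |y|]. *)
Lemma adjoint_le_opnorm y : rnorm (adjoint A y) <= opnorm A * rnorm y.
Proof.
have [->|x0] := eqVneq (rnorm (adjoint A y)) 0.
  by rewrite mulr_ge0 ?opnorm_ge0 ?rnorm_ge0.
have xp : 0 < rnorm (adjoint A y) by rewrite lt_def x0 rnorm_ge0.
rewrite -(ler_pM2l xp) -expr2 -re_inner_sqr -re_inner_adjoint.
apply: le_trans (ler_norm _) (le_trans (cauchy_schwarz _ _) _).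
by rewrite mulrA [_ * opnorm A]mulrC ler_wpM2r ?rnorm_ge0 ?rnorm_le_opnorm.
Qed.

End Adjoint.

(** * Orbits of symmetric firmly nonexpansive maps *)

Section FirmlyNonexpansive.
Context {R : realType} {s : scalar_kind} {X : hilbertType R s}.
Variable P : X -> X.
Hypothesis PB : forall x y, P (x - y) = P x - P y.
Hypothesis P_symmetric : forall x y, re_inner (P x) y = re_inner x (P y).
Hypothesis P_firm : forall x, rnorm (P x) ^+ 2 <= re_inner (P x) x.

Lemma firm_nonexpansive x : rnorm (P x) <= rnorm x.
Proof.
have [->|x0] := eqVneq (rnorm (P x)) 0; first exact: rnorm_ge0.
have xp : 0 < rnorm (P x) by rewrite lt_def x0 rnorm_ge0.
rewrite -(ler_pM2l xp) -expr2.
exact: le_trans (P_firm x) (le_trans (ler_norm _) (cauchy_schwarz _ _)).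
Qed.

(** Symmetry makes [<P^m v, P^n v>] depend on [m + n] only, so these numbers govern
all distances within the orbit of [v]. *)
Let moment (v : X) k := re_inner (iter k P v) v.

Let momentD v m n : moment v (m + n) = re_inner (iter m P v) (iter n P v).
Proof.
elim: n m => [|n IHn] m; first by rewrite addn0.
by rewrite addnS -addSn IHn /= P_symmetric.
Qed.

(** For odd [k] this is firmness at a point of the orbit; for even [k] it is
nonexpansiveness combined with Cauchy-Schwarz. *)
Let moment_step v k : moment v k.+1 <= moment v k.
Proof.
rewrite -(odd_double_half k) -addnn; case: (odd k); move: k./2 => j.
  rewrite [X in moment v X <= _](_ : _ = j.+1 + j.+1)%N; last first.
    by rewrite addSn addnS.
  by rewrite add1n -addSn !momentD re_inner_sqr; exact: P_firm.
rewrite add0n -addSn !momentD re_inner_sqr.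
apply: le_trans (ler_norm _) (le_trans (cauchy_schwarz _ _) _).
by rewrite expr2 ler_wpM2r ?rnorm_ge0 ?firm_nonexpansive.
Qed.

Let moment_noninc v : {homo moment v : m n / (m <= n)%N >-> n <= m}.
Proof.
apply: homo_leq (moment_step v); first exact: lexx.
by move=> x y z yx zy; exact: le_trans zy yx.
Qed.

Let moment_ge0 v k : 0 <= moment v k.
Proof.
apply: (@le_trans _ _ (moment v (k + k))).
  by rewrite momentD re_inner_sqr sqr_ge0.
by apply: moment_noninc; rewrite leq_addr.
Qed.

(** The moments converge, and [|P^m v - P^n v|^2] is the combination of the moments
of orders [2m], [m + n] and [2n] with coefficients [1, -2, 1], whose sum is [0]. *)
Lemma firm_orbit_cauchy (v : X) (e : R) : 0 < e ->
  exists N, forall m n, (N <= m)%N -> (N <= n)%N ->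
    rnorm (iter m P v - iter n P v) <= e.
Proof.
move=> e0.
have cv : cvgn (moment v).
  apply: nonincreasing_is_cvgn => //.
  by exists 0 => _ [k _ <-]; exact: moment_ge0.
have e2 : 0 < e ^+ 2 / 2 by rewrite divr_gt0 ?exprn_gt0.
have /cvgrPdist_le/(_ _ e2)[N _ NP] : moment v @ \oo --> limn (moment v) by [].
have lb k : limn (moment v) <= moment v k by exact: nonincreasing_cvgn_ge.
exists N => m n Nm Nn; rewrite -ler_sqr ?nnegrE ?rnorm_ge0 ?(ltW e0)//.
rewrite rnorm_sqrB -!re_inner_sqr -!momentD.
have Nmm := NP _ (leq_trans Nm (leq_addr m m)).
have Nnn := NP _ (leq_trans Nn (leq_addr n n)).
move: (lb (m + n)%N) Nmm Nnn; rewrite /= !ler_norml => ? /andP[? ?] /andP[? ?].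
lra.
Qed.

Variables (p e : nat -> X) (c : R^nat).
Hypothesis p_le : forall k, rnorm (p k) <= c k.
Hypothesis c_summable : cvgn (series c).
Hypothesis eS : forall k, e k.+1 = P (e k + p k).

(** Since [P] is nonexpansive, each perturbation contributes at most its own norm to
the distance between the perturbed and the unperturbed orbit. *)
Let perturbation_le m n :
  rnorm (e (n + m) - iter n P (e m)) <= series c (n + m)%N - series c m.
Proof.
elim: n => [|n IHn]; first by rewrite add0n !subrr rnorm0.
rewrite addSn eS iterS -PB; apply: le_trans (firm_nonexpansive _) _.
rewrite addrAC; apply: le_trans (rnormD _ _) _.
rewrite seriesSr addrAC.
by apply: lerD => //; exact: p_le.
Qed.

(** Wait until the remaining perturbations sum to at most [d / 3], then until the
unperturbed orbit started there has oscillation at most [d / 3]. Passing to the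
limit in the recursion shows that the limit is fixed. *)
Lemma perturbed_orbit_cvg : exists2 w, P w = w & e k @[k --> \oo] --> w.
Proof.
have c0 k : 0 <= c k := le_trans (rnorm_ge0 _) (p_le k).
have series_le k : series c k <= limn (series c).
  apply: nondecreasing_cvgn_le => //.
  by apply/nondecreasing_seqP => n; rewrite seriesSr lerDl.
have /cvg_ex[w ew] : cvgn e.
  apply: cauchy_rnorm_cvgn => d d0.
  have d3 : 0 < d / 3 by rewrite divr_gt0.
  have /cvgrPdist_le/(_ _ d3)[m _ /(_ m (leqnn m)) /= mP] :
    series c @ \oo --> limn (series c) by [].
  have [N NP] := firm_orbit_cauchy (e m) _ d3.
  have near_orbit k : rnorm (e (k + m) - iter k P (e m)) <= d / 3.
    apply: le_trans (perturbation_le _ _) (le_trans _ mP).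
    by apply: le_trans (ler_norm _); rewrite lerB.
  have shift k : (m + N <= k)%N -> (N <= k - m)%N /\ (k - m + m)%N = k.
    move=> Nk; have mk := leq_trans (leq_addr N m) Nk.
    by rewrite leq_subRL// subnK.
  exists (m + N)%N => i j /shift[Ni <-] /shift[Nj <-].
  apply: le_trans (rdist_triangle (iter (i - m) P (e m)) _ _) _.
  have := rdist_triangle (iter (j - m) P (e m)) (iter (i - m) P (e m))
    (e (j - m + m)%N).
  rewrite [X in _ <= _ + X -> _]rdistC.
  have := near_orbit (i - m)%N; have := near_orbit (j - m)%N.
  have := NP _ _ Ni Nj; lra.
exists w => //; apply/esym/subr0_eq/rnorm_eq0/le_anti.
rewrite rnorm_ge0 andbT; apply/ler_addgt0Pr => d d0; rewrite add0r.
have d3 : 0 < d / 3 by rewrite divr_gt0.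
have c_to0 := cvg_series_cvg_0 c_summable.
have [N1 _ N1P] := (cvg_rnormP _ _).1 ew _ d3.
have [N2 _ N2P] := (cvgrPdist_le _ _).1 c_to0 _ d3.
pose k := maxn N1 N2.
have := N1P k.+1 (leqW (leq_maxl N1 N2)); have := N1P k (leq_maxl N1 N2).
have := N2P k (leq_maxr N1 N2); rewrite /= sub0r normrN ger0_norm// => ck ek ekS.
have step : rnorm (e k.+1 - P w) <= rnorm (w - e k) + c k.
  rewrite eS -PB addrAC (rdistC w).
  apply: le_trans (firm_nonexpansive _) (le_trans (rnormD _ _) _).
  by rewrite lerD2l.
have := rdist_triangle (e k.+1) w (P w); lra.
Qed.

End FirmlyNonexpansive.

(** * The Landweber iteration *)

Section LandweberConvergence.
Context {R : realType} {s : scalar_kind} {X Y : hilbertType R s}.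
Context {A : {linear X -> Y}} {lambda : R}.
Hypothesis A_bounded : bounded_operator A.
Hypothesis lambda_gt0 : 0 < lambda.
Hypothesis lambda_small : lambda * opnorm A ^+ 2 < 1.

(** The step for data [0], which also governs the error of the step for exact data. *)
Definition landweber_step (x : X) : X :=
  x - of_real s lambda *: adjoint A (A x).

Local Notation P := landweber_step.

Lemma landweber_stepB x y : P (x - y) = P x - P y.
Proof.
rewrite /P linearB (adjointD A_bounded) (adjointN A_bounded) scalerDr scalerN.
by rewrite !opprD !opprK addrACA.
Qed.

Lemma landweber_step_symmetric x y : re_inner (P x) y = re_inner x (P y).
Proof.
rewrite /P re_innerDl re_innerDr re_innerNl re_innerNr re_innerZl re_innerZr.
rewrite (re_innerC (adjoint A _)) -!(re_inner_adjoint A_bounded).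
by rewrite (re_innerC (A y)).
Qed.

(** The gap is [<P x, x> - |P x|^2 = lambda (|A x|^2 - lambda |A* A x|^2)], and
[|A* A x| <= |A| |A x|]. *)
Lemma landweber_step_firm x : rnorm (P x) ^+ 2 <= re_inner (P x) x.
Proof.
have adj2 : lambda * rnorm (adjoint A (A x)) ^+ 2 <= rnorm (A x) ^+ 2.
  have : rnorm (adjoint A (A x)) ^+ 2 <= opnorm A ^+ 2 * rnorm (A x) ^+ 2.
    rewrite -exprMn ler_sqr ?nnegrE ?rnorm_ge0//.
      exact: adjoint_le_opnorm.
    by rewrite mulr_ge0 ?rnorm_ge0 ?opnorm_ge0.
  move=> /(ler_wpM2l (ltW lambda_gt0)) /le_trans; apply.
  by rewrite mulrA ler_piMl ?sqr_ge0// ltW.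
rewrite /P rnorm_sqrB re_innerDl re_innerNl !re_innerZl re_innerZr rnormZ.
rewrite (re_innerC (adjoint A _)) -(re_inner_adjoint A_bounded) !re_inner_sqr.
rewrite (gtr0_norm lambda_gt0) exprMn.
have := ler_wpM2l (ltW lambda_gt0) adj2; lra.
Qed.

(** A fixed point has [A* A x = 0], hence [|A x|^2 = <x, A* A x> = 0]. *)
Lemma landweber_step_fixed x : P x = x -> A x = 0.
Proof.
rewrite /P -[RHS]addr0 => /addrI/(congr1 (re_inner x)).
rewrite re_innerNr re_innerZr -(re_inner_adjoint A_bounded) re_inner_sqr.
rewrite /re_inner linear0r scalar_re0 => /eqP.
by rewrite oppr_eq0 mulf_eq0 (gt_eqF lambda_gt0) sqrf_eq0 => /eqP/rnorm_eq0.
Qed.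

Variables (t : R^nat) (Phi : nat -> X -> X).
Hypothesis t_ge0 : forall k, 0 <= t k.
Hypothesis t_summable : cvgn (series t).
Hypothesis Phi_bounded : exists M : R, forall k x, rnorm (Phi k x) <= M.

Lemma landweber_exact_cvg y : range A y ->
  exists2 x, A x = y & landweber A lambda t Phi k y @[k --> \oo] --> x.
Proof.
move=> [x0 _ <-]; have [M PhiM] := Phi_bounded.
pose x k := landweber A lambda t Phi k (A x0).
pose p k := of_real s (t k) *: Phi k (x k).
have p_le k : rnorm (p k) <= M * t k.
  by rewrite rnormZ ger0_norm// mulrC ler_wpM2r.
have sum_p : cvgn (series (fun k => M * t k)).
  exact: is_cvg_seriesZ M t_summable.
have errS k : x k.+1 - x0 = P (x k - x0 + p k).
  by rewrite (addrAC (x k)) /P linearB [RHS]addrAC.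
have [w Pw xw] := perturbed_orbit_cvg _ landweber_stepB
  landweber_step_symmetric landweber_step_firm _ (fun k => x k - x0) _
  p_le sum_p errS.
exists (w + x0); first by rewrite linearD (landweber_step_fixed _ Pw) add0r.
have -> : landweber A lambda t Phi ^~ (A x0) = (fun k => x k - x0 + x0).
  by apply/funext => k; rewrite subrK.
by apply: cvgD => //; exact: cvg_cst.
Qed.

Lemma landweber_lim_cvg y : range A y ->
  landweber A lambda t Phi k y @[k --> \oo] --> landweber_lim A lambda t Phi y.
Proof. by move=> /landweber_exact_cvg[x _ xl]; apply/cvgP: xl. Qed.

Lemma landweber_lim_right_inverse :
  right_inverse_on_range A (landweber_lim A lambda t Phi).
Proof.
move=> y /landweber_exact_cvg[x Ax xl].
by rewrite /landweber_lim (cvg_lim _ xl).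
Qed.

End LandweberConvergence.

Section LandweberContinuity.
Context {R : realType} {s : scalar_kind}.

Lemma lipschitz_continuous {V W : normedModType (scalar_field R s)}
    (f : V -> W) (C : R) :
  (forall x y, rnorm (f x - f y) <= C * rnorm (x - y)) -> continuous f.
Proof.
move=> fC x; apply/cvg_rnormP => e e0.
have C1 : 0 < `|C| + 1 by rewrite ltr_wpDl.
have : 0 < e / (`|C| + 1) by rewrite divr_gt0.
move=> /((cvg_rnormP (F:=nbhs x) id x).1 cvg_id); apply: filterS => y.
rewrite ler_pdivlMr// => xy; apply: le_trans (fC x y) (le_trans _ xy).
rewrite mulrC ler_wpM2l ?rnorm_ge0//.
by apply: le_trans (ler_norm _) _; rewrite lerDl.
Qed.

Lemma landweber_continuous {X Y : hilbertType R s} (A : {linear X -> Y})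
    (lambda : R) (t : R^nat) (Phi : nat -> X -> X) :
  bounded_operator A -> (forall k, continuous (Phi k)) ->
  forall k, continuous (landweber A lambda t Phi k).
Proof.
move=> A_bounded Phi_cont.
have A_cont : continuous A.
  have [C AC] := A_bounded.
  by apply: (@lipschitz_continuous _ _ _ C) => x y; rewrite -linearB.
have adj_cont : continuous (adjoint A).
  apply: (@lipschitz_continuous _ _ _ (opnorm A)) => x y.
  rewrite -(adjointN A_bounded) -(adjointD A_bounded).
  exact: adjoint_le_opnorm.
elim=> [|k IHk] z; first exact: cvg_cst.
have half_cont : landweber A lambda t Phi k u
    + of_real s (t k) *: Phi k (landweber A lambda t Phi k u) @[u --> z] -->
  landweber A lambda t Phi k z
    + of_real s (t k) *: Phi k (landweber A lambda t Phi k z).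
  apply: cvgD; first exact: IHk.
  apply: cvgZr; apply: (cvg_comp _ _ (IHk z)); exact: Phi_cont.
apply: cvgB => //.
apply: cvgZr; apply: (@cvg_comp _ _ _ _ (adjoint A) _ _ _ _ (adj_cont _)).
apply: cvgB; last exact: cvg_id.
exact: (cvg_comp _ _ half_cont (A_cont _)).
Qed.

End LandweberContinuity.

(** * A-priori choice of the stopping index *)

Section ParameterChoice.
Context {R : realType} {s : scalar_kind} {X Y : hilbertType R s}.
Variables (Rinv : Y -> X) (Rk : nat -> Y -> X) (y : Y).
Hypothesis Rk_continuous : forall k, continuous (Rk k).
Hypothesis Rk_cvg : Rk k y @[k --> \oo] --> Rinv y.

(** The tolerance shrinks with [k], so that a stable index tending to infinity has a
vanishing data error. *)
Let stable k (delta : R) := forall yd : Y,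
  rnorm (yd - y) <= delta -> rnorm (Rk k y - Rk k yd) <= k.+1%:R^-1.

Let stable_near0 k : \forall delta \near 0^'+, stable k delta.
Proof.
have k0 : 0 < k.+1%:R^-1 :> R by rewrite invr_gt0.
have near_y : \forall z \near y, rnorm (Rk k y - Rk k z) <= k.+1%:R^-1.
  exact: (cvg_rnormP _ _).1 (Rk_continuous k y) _ k0.
have [e /= e0 eP] := (@nbhs_normP _ Y _ _).1 near_y.
have re : of_real s (scalar_re e) = e by apply/scalar_reK/ltW.
have re0 : 0 < scalar_re e by rewrite -(of_real_lt (s:=s)) re of_real0.
near=> delta => yd yyd; apply: eP => /=.
rewrite -of_real_rnorm -re of_real_lt rdistC; apply: le_lt_trans yyd _.
by near: delta; exact: nbhs_right_lt.
Unshelve. all: by end_near. Qed.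

(** The cut-off at [1 / delta] only keeps the maximum finite. If no index is stable the
value is [0]; this does not happen for small [delta]. *)
Let kappa (delta : R) : nat :=
  \max_(k < Num.truncn delta^-1 | `[< stable k delta >]) k.

Let kappa_near0 K :
  \forall delta \near 0^'+, (K <= kappa delta)%N /\ stable (kappa delta) delta.
Proof.
have K0 : 0 < K.+2%:R^-1 :> R by rewrite invr_gt0.
near=> delta.
have delta0 : 0 < delta by near: delta; exact: nbhs_right_gt.
have K_lt : (K < Num.truncn delta^-1)%N.
  rewrite truncn_ge_nat ?invr_ge0 ?(ltW delta0)//.
  rewrite -(invrK K.+1%:R) lef_pV2 ?posrE ?invr_gt0//.
  by near: delta; apply: nbhs_right_le; rewrite invr_gt0.
have stK : stable K delta by near: delta; exact: stable_near0.
pose i0 := Ordinal K_lt.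
have i0P : `[< stable i0 delta >] by apply/asboolP.
split.
  exact: (@leq_bigmax_cond _ (fun i : 'I__ => `[< stable i delta >])
    (fun i => i : nat) i0).
have [|i /asboolP iP kappaE] := @eq_bigmax_cond _
  [pred i : 'I_(Num.truncn delta^-1) | `[< stable i delta >]] (fun i => i : nat).
  by apply/card_gt0P; exists i0.
by rewrite (_ : kappa delta = i).
Unshelve. all: by end_near. Qed.

Lemma parameter_choice_exists : exists kappa, parameter_choice_rule Rinv Rk y kappa.
Proof.
exists kappa.
have kappa_oo : kappa delta @[delta --> 0^'+] --> \oo.
  by apply/cvgnyPge => K; apply: filterS (kappa_near0 K) => delta [].
split=> //.
apply: (@squeeze_cvge _ _ _ _ (cst 0%E) _
  (fun delta => (rnorm (Rinv y - Rk (kappa delta) y)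
                 + (kappa delta).+1%:R^-1)%:E)).
- near=> delta.
  have delta0 : 0 < delta by near: delta; exact: nbhs_right_gt.
  have [_ st] : (0 <= kappa delta)%N /\ stable (kappa delta) delta.
    by near: delta; exact: kappa_near0.
  apply/andP; split.
    apply: (@le_trans _ _ (rnorm (Rinv y - Rk (kappa delta) y))%:E).
      by rewrite lee_fin rnorm_ge0.
    by apply: ereal_sup_ubound; exists y => //=; rewrite subrr rnorm0 ltW.
  apply: ge_ereal_sup => _ [yd /= yyd <-]; rewrite lee_fin.
  apply: le_trans (rdist_triangle (Rk (kappa delta) y) _ _) _.
  by rewrite lerD2l; exact: st.
- exact: cvg_cst.
- apply: cvg_EFin; first by near=> delta.
  rewrite -[X in _ --> X]addr0.
  apply: (@cvg_comp _ _ _ kappa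
    (fun k => rnorm (Rinv y - Rk k y) + k.+1%:R^-1) _ \oo) => //.
  apply: cvgD; last exact: cvg_harmonic.
  exact/cvg_rnorm0P.
Unshelve. all: by end_near. Qed.

Lemma parameter_choice_noisy (kap : R -> nat) (yd : R -> Y) :
  parameter_choice_rule Rinv Rk y kap ->
  (forall delta, 0 < delta -> rnorm (y - yd delta) <= delta) ->
  rnorm (Rinv y - Rk (kap delta) (yd delta)) @[delta --> 0^'+] --> 0.
Proof.
move=> [_ err0] yd_le; apply: (@fine_cvg _ _ _ _
  (fun delta => (rnorm (Rinv y - Rk (kap delta) (yd delta)))%:E)).
apply: (squeeze_cvge _ (cvg_cst 0%E) err0); near=> delta.
have delta0 : 0 < delta by near: delta; exact: nbhs_right_gt.
rewrite lee_fin rnorm_ge0; apply: ereal_sup_ubound; exists (yd delta) => //=.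
by rewrite rdistC; exact: yd_le.
Unshelve. all: by end_near. Qed.

End ParameterChoice.

Theorem theorem3p2 (R : realType) (s : scalar_kind) (X Y : hilbertType R s)
    (A : {linear X -> Y}) (lambda : R) (t : R^nat) (Phi : nat -> X -> X)
    (hA : bounded_operator A)
    (hlambda0 : 0 < lambda) (hlambda1 : lambda * opnorm A ^+ 2 < 1)
    (ht0 : forall k, 0 <= t k) (ht : cvgn (series t))
    (hPhi : forall k, continuous (Phi k))
    (hPhib : exists M : R, forall k x, rnorm (Phi k x) <= M) :
  let Bk := landweber A lambda t Phi in
  let B := landweber_lim A lambda t Phi in
  (forall y, range A y ->
    exists kappa : R -> nat,
      regularization_method A B Bk y kappa /\
      forall yd : R -> Y,
        (forall delta, 0 < delta -> rnorm (y - yd delta) <= delta) ->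
        rnorm (B y - Bk (kappa delta) (yd delta)) @[delta --> 0^'+] --> 0) /\
  regularization A B Bk.
Proof.
move=> Bk B.
have B_inv : right_inverse_on_range A B by exact: landweber_lim_right_inverse.
have Bk_cont : forall k, continuous (Bk k) by exact: landweber_continuous.
have rule y : range A y -> exists kappa, parameter_choice_rule B Bk y kappa.
  by move=> Ay; apply: parameter_choice_exists => //; exact: landweber_lim_cvg.
split=> [y /rule[kappa kappaP]|//].
by exists kappa; split=> // yd; exact: parameter_choice_noisy.
Qed.
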